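(* Let $\mathcal{M}\in\{0,\ast,?\}^{1\times p}$ and $\mathcal{N}\in\{0,\ast,?\}^{r\times p}$ be pattern matrices, let $\mathrm{col}(\mathcal{M},\mathcal{N})\in\{0,\ast,?\}^{(r+1)\times p}$ be the pattern matrix with first row $\mathcal{M}$ followed by the rows of $\mathcal{N}$, and consider the graph $G(\mathrm{col}(\mathcal{M},\mathcal{N}))=(V,E)$. Then $\mathcal{M}$ is independent of $\mathcal{N}$ if and only if node $1\in V$ is contained in the derived set $S(\mathrm{col}(\mathcal{M},\mathcal{N}))$.
   Context: A pattern matrix has entries in the symbols $\{0,\ast,?\}$. For $\mathcal{M}\in\{0,\ast,?\}^{p\times q}$ let $\mathcal{P}(\mathcal{M})=\{M\in\mathbb{R}^{p\times q}: M_{ij}=0\text{ if }\mathcal{M}_{ij}=0,\ M_{ij}\ne0\text{ if }\mathcal{M}_{ij}=\ast\}$. Independence: for $\mathcal{M}\in\{0,\ast,?\}^{1\times q}$ and $\mathcal{N}\in\{0,\ast,?\}^{r\times q}$, $\mathcal{M}$ is independent of $\mathcal{N}$ if for all $M\in\mathcal{P}(\mathcal{M})$, $N\in\mathcal{P}(\mathcal{N})$, $z_1\in\mathbb{R}$ and $z_2\in\mathbb{R}^r$, $z_1M+z_2^\top N=0$ implies $z_1=0$. Graph: for a pattern matrix $\mathcal{T}\in\{0,\ast,?\}^{s\times q}$, $G(\mathcal{T})=(V,E)$ is the directed graph with node set $V=\{1,\dots,\max(s,q)\}$ and edge set $E=E_\ast\cup E_?$, where $E_\ast=\{(i,j)\in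 V\times V:\mathcal{T}_{ji}=\ast\}$ and $E_?=\{(i,j)\in V\times V:\mathcal{T}_{ji}=?\}$ (indices $(j,i)$ outside the range of $\mathcal{T}$ give no edge; self-loops are allowed). Node $j$ is an out-neighbor of node $i$ if $(i,j)\in E$. Derived set: initially color all nodes of $G(\mathcal{T})$ white. If a node $i$ (of any color) has exactly one white out-neighbor $j$ (possibly $j=i$) and $(i,j)\in E_\ast$, change the color of $j$ to black. Repeat until no more changes are possible. The set of all black nodes obtained is the derived set $S(\mathcal{T})$. *)

(* Defs.v *)
From HB Require Import structures.
From mathcomp Require Import all_boot all_order all_algebra.
From mathcomp Require Export reals.

Set Implicit Arguments.
Unset Strict Implicit.
Unset Printing Implicit Defensive.

Import GRing.Theory.
Local Open Scope ring_scope.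

Inductive symbol := Zero | Star | Quest.

Definition symbol_code (a : symbol) : option bool :=
  match a with Zero => None | Star => Some true | Quest => Some false end.

Definition symbol_decode (c : option bool) : symbol :=
  match c with None => Zero | Some true => Star | Some false => Quest end.

Lemma symbol_codeK : cancel symbol_code symbol_decode.
Proof. by case. Qed.

HB.instance Definition _ := Equality.copy symbol (can_type symbol_codeK).

Definition pattern_class (R : realType) (s q : nat) (T : 'M[symbol]_(s, q))
    (A : 'M[R]_(s, q)) : Prop :=
  forall i j, (T i j = Zero -> A i j = 0) /\ (T i j = Star -> A i j != 0).

Definition independent (R : realType) (r q : nat) (M : 'M[symbol]_(1, q))
    (N : 'M[symbol]_(r, q)) : Prop :=
  forall (A : 'M[R]_(1, q)) (B : 'M[R]_(r, q)) (z1 : R) (z2 : 'cV[R]_r),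
    pattern_class M A -> pattern_class N B ->
    z1 *: A + z2^T *m B = 0 -> z1 = 0.

Section Graph.

Variables (s q : nat) (T : 'M[symbol]_(s, q)).

(* The nodes 1, ..., max(s, q) are numbered from 0 here. *)
Definition node := 'I_(maxn s q).

(* The transposition is intended: an edge from i to j is the entry in row j and
   column i.  Pairs that do not index an entry of T give no edge. *)
Definition edge_with (a : symbol) (i j : node) : bool :=
  [exists k : 'I_s, exists l : 'I_q,
    [&& k == j :> nat, l == i :> nat & T k l == a]].

Definition edge_star : rel node := edge_with Star.
Definition edge_quest : rel node := edge_with Quest.
Definition edge : rel node := [rel i j | edge_star i j || edge_quest i j].

(* A colouring is represented by its set B of black nodes. *)
Definition white_out (B : {set node}) (i : node) : {set node} :=
  [set j | edge i j & j \notin B].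

Definition forces (B : {set node}) (i j : node) : bool :=
  (white_out B i == [set j]) && edge_star i j.

Definition color_step : rel {set node} :=
  [rel B B' | [exists i, exists j, forces B i j && (B' == j |: B)]].

Definition final_coloring (S : {set node}) : bool :=
  connect color_step set0 S && [forall S', ~~ color_step S S'].

(* The default value is never used: by derived_setP below there is exactly one
   final colouring, whatever the order of the colour changes. *)
Definition derived_set : {set node} := odflt set0 [pick S | final_coloring S].

Lemma color_stepP (B B' : {set node}) :
  reflect (exists i j, forces B i j /\ B' = j |: B) (color_step B B').
Proof.
apply: (iffP existsP) => [[i /existsP[j /andP[f /eqP->]]]|[i [j [f ->]]]].
  by exists i, j.
by exists i; apply/existsP; exists j; rewrite f eqxx.
Qed.

Lemma forces_notin (B : {set node}) i j : forces B i j -> j \notin B.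
Proof.
by case/andP=> /eqP/setP/(_ j); rewrite !inE eqxx => /andP[].
Qed.

Lemma forces_mono (B C : {set node}) i j :
  B \subset C -> forces B i j -> j \notin C -> forces C i j.
Proof.
move=> sBC /andP[/eqP/setP wB st] jC; rewrite /forces st andbT.
apply/eqP/setP=> k; move/(_ k): wB; rewrite !inE => wB.
have [->|nkj] := eqVneq k j; first by rewrite jC /edge /= st.
move: wB; rewrite (negPf nkj); case: (edge i k) => //= /negbFE kB.
by rewrite (subsetP sBC).
Qed.

Lemma reachable_sub_final (B S : {set node}) :
  connect color_step set0 B -> final_coloring S -> B \subset S.
Proof.
case/connectP=> p pth -> /andP[_ /forallP fin]; move: pth.
have: set0 \subset S by exact: sub0set.
elim: p set0 => //= C p IH B0 sB0 /andP[/color_stepP[i [j [f ->]]]].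
apply: IH; rewrite subUset sB0 sub1set andbT; apply/negPn/negP=> jS.
move: (fin (j |: S)) => /negP; apply; apply/color_stepP; exists i, j.
by split=> //; exact: forces_mono f jS.
Qed.

Lemma final_coloring_exists : exists S, final_coloring S.
Proof.
pose P (B : {set node}) := connect color_step set0 B.
have P0 : P set0 by exact: connect0.
case: (arg_maxnP (fun B : {set node} => #|B|) P0) => S PS maxS.
exists S; apply/andP; split=> //; apply/forallP=> S'; apply/negP=> stp.
have /maxS : P S' by apply: connect_trans PS (connect1 stp).
case/color_stepP: stp => i [j [/forces_notin jS ->]] /=.
by rewrite cardsU1 jS /= add1n /= => h; move: (leq_trans (ltnSn _) h); rewrite ltnn.
Qed.

Lemma derived_setP (S : {set node}) :
  reflect (S = derived_set) (final_coloring S).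
Proof.
have fin : final_coloring derived_set.
  rewrite /derived_set; case: pickP => //= none.
  by have [S0] := final_coloring_exists; rewrite none.
apply: (iffP idP) => [finS|->//]; apply/eqP; rewrite eqEsubset.
by case/andP: (finS) (fin) => cS _ /andP[cD _]; rewrite !reachable_sub_final.
Qed.

End Graph.

Definition node1 (r q : nat) : node (1 + r) q :=
  widen_ord (leq_maxl (1 + r) q) ord0.

(* Main.v *)
Require Import Defs.
From mathcomp Require Import all_boot all_order all_algebra.

(** Stack a realization of [M] on a realization of [N] and put [z1] in front of
    [z2]: independence says that every row vector in the left kernel of a
    realization of the stacked pattern [T] has first entry [0].  More
    generally, the nodes of the derived set are exactly the entries that
    vanish on the left kernel of every realization of [T].

    Black nodes give zeros.  A vector [z] with [z *m A = 0] satisfies one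
    linear equation per column.  When the entries already known to vanish are
    removed, the equation of column [i] only involves the white out-neighbours
    of [i]; if there is just one, with a nonzero coefficient, that entry of [z]
    vanishes too.  The colour change rule is this deduction, so the property
    survives every step ([color_step_kernel], [derived_set_kernel]).

    White nodes do not.  Let [z] be the indicator vector of the white rows of
    the final colouring.  It is in the left kernel of [A] as soon as the white
    entries of each column of [A] add up to [0].  As no rule applies any more, a
    column with a white [Star] has a second white entry that is not forced to
    be [0], and this entry can balance the others ([balanced_column]); so a
    single realization annihilates [z] ([white_indicator_kernel]). *)

Set Implicit Arguments.
Unset Strict Implicit.
Unset Printing Implicit Defensive.

Import GRing.Theory Num.Theory.
Local Open Scope ring_scope.

Definition row_node (s q : nat) (k : 'I_s) : node s q :=
  widen_ord (leq_maxl s q) k.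

Definition col_node (s q : nat) (l : 'I_q) : node s q :=
  widen_ord (leq_maxr s q) l.

Arguments row_node {s} q k.
Arguments col_node s {q} l.

Lemma row_node_inj (s q : nat) : injective (@row_node s q).
Proof. by move=> k k' /(congr1 val) /= e; apply: val_inj. Qed.

Section Kernel.

Variables (s q : nat) (T : 'M[symbol]_(s, q)).

Lemma edge_withP (a : symbol) (i j : node s q) :
  reflect (exists k l, [/\ j = row_node q k, i = col_node s l & T k l = a])
    (edge_with T a i j).
Proof.
apply: (iffP existsP) => [[k /existsP[l /and3P[/eqP ek /eqP el /eqP eT]]]|].
  by exists k, l; split=> //; apply: val_inj.
case=> k [l [-> -> <-]]; exists k; apply/existsP; exists l.
by rewrite !eqxx.
Qed.

Lemma edge_with_node (a : symbol) (k : 'I_s) (l : 'I_q) :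
  edge_with T a (col_node s l) (row_node q k) = (T k l == a).
Proof.
apply/edge_withP/eqP => [[k' [l' [ek el <-]]]|eT]; last by exists k, l.
by congr (T _ _); apply: val_inj; [case: ek | case: el].
Qed.

Lemma edge_node (k : 'I_s) (l : 'I_q) :
  edge T (col_node s l) (row_node q k) = (T k l != Zero).
Proof.
by rewrite /edge /= /edge_star /edge_quest !edge_with_node; case: (T k l).
Qed.

(** Only rows can be out-neighbours: a node beyond the last row has no
    incoming edge. *)
Lemma edge_row_node (i j : node s q) : edge T i j -> exists k, j = row_node q k.
Proof. by case/orP => /edge_withP[k [l [-> _ _]]]; exists k. Qed.

Section Soundness.

Variables (R : realType) (A : 'M[R]_(s, q)) (z : 'rV[R]_s).
Hypotheses (TA : pattern_class T A) (zA : z *m A = 0).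

(** In the equation of the forcing column, every term but the one of the forced
    row has either a zero coefficient (no edge) or a zero unknown (black). *)
Lemma color_step_kernel (B B' : {set node s q}) :
  color_step T B B' ->
  (forall k, row_node q k \in B -> z 0 k = 0) ->
  forall k, row_node q k \in B' -> z 0 k = 0.
Proof.
case/color_stepP => i [j [/andP[/eqP wB /edge_withP[k0 [l [ej ei Tk0]]]] ->]].
move=> zB k; rewrite !inE => /orP[|/zB//]; rewrite ej => /eqP/row_node_inj->.
have: (z *m A) 0 l = 0 by rewrite zA mxE.
rewrite mxE (bigD1 k0) //= big1 => [|h nhk0].
  by rewrite addr0 => /eqP; rewrite mulf_eq0 (negPf ((TA k0 l).2 Tk0)) orbF => /eqP.
have [/zB->|hB] := boolP (row_node q h \in B); first by rewrite mul0r.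
move/setP/(_ (row_node q h)): wB.
rewrite !inE hB andbT ei edge_node ej (inj_eq (@row_node_inj s q)) (negPf nhk0).
by move/negbFE/eqP => /(TA h l).1 ->; rewrite mulr0.
Qed.

Lemma derived_set_kernel (k : 'I_s) :
  row_node q k \in derived_set T -> z 0 k = 0.
Proof.
have /derived_setP/andP[/connectP[steps pth ->] _] : derived_set T = derived_set T.
  by [].
have: forall h, row_node q h \in set0 -> z 0 h = 0 by move=> h; rewrite inE.
elim: steps set0 pth k => [|C steps IH] B /=; first by move=> _ k zB /zB.
by case/andP=> stp /IH{}IH k zB; apply: IH; exact: color_step_kernel stp zB.
Qed.

End Soundness.

(** Put [1] at every [Star] and [0] elsewhere, then correct one entry [k] of [W]
    to minus the number of other stars in [W].  This is legitimate even when
    [c k] is a [Star], provided that [W] has another star: the correction is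
    then nonzero. *)
Lemma balanced_column (R : realType) (c : 'I_s -> symbol) (W : {set 'I_s}) :
  (forall j, j \in W -> c j = Star ->
     exists k, [/\ k \in W, k != j & c k != Zero]) ->
  exists a : 'I_s -> R,
    (forall k, (c k = Zero -> a k = 0) /\ (c k = Star -> a k != 0)) /\
    \sum_(k in W) a k = 0.
Proof.
move=> second; pose ind (k : 'I_s) : R := (c k == Star)%:R.
have indP k : (c k = Zero -> ind k = 0) /\ (c k = Star -> ind k != 0).
  by rewrite /ind; split=> ->; rewrite ?eqxx ?oner_eq0.
have [/existsP[j /andP[jW /eqP cj]]|] := boolP [exists j, (j \in W) && (c j == Star)];
  last first.
  move=> noStar; exists ind; split=> //; apply: big1 => k kW.
  move: noStar; rewrite negb_exists => /forallP/(_ k).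
  by rewrite kW /ind /= => /negPf->.
have [k [kW nkj ck]] := second j jW cj.
pose rest : R := \sum_(h in W | h != k) ind h.
have rest_neq0 : rest != 0.
  rewrite /rest (bigD1 j) /=; last by rewrite jW eq_sym.
  rewrite {1}/ind cj eqxx lt0r_neq0 //.
  by apply: ltr_wpDr ltr01; apply: sumr_ge0 => h _; exact: ler0n.
exists (fun h => if h == k then - rest else ind h); split=> [h|].
  have [->|_] := eqVneq h k; last exact: indP.
  by split=> [/eqP|_]; rewrite ?(negPf ck) // oppr_eq0.
rewrite (bigD1 k) //= eqxx (eq_bigr ind) => [|h /andP[_ /negPf->] //].
exact: addNr.
Qed.

(** The columns can be balanced independently of each other, since no entry
    belongs to two of them. *)
Lemma white_indicator_kernel (R : realType) :
  exists2 A : 'M[R]_(s, q), pattern_class T A &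
    (\row_k (row_node q k \notin derived_set T)%:R) *m A = 0.
Proof.
set S := derived_set T; pose W := [set k : 'I_s | row_node q k \notin S].
have /derived_setP/andP[_ /forallP stable] : S = derived_set T by [].
have second l j : j \in W -> T j l = Star ->
    exists k, [/\ k \in W, k != j & T k l != Zero].
  rewrite inE => jS Tj.
  have: ~~ forces T S (col_node s l) (row_node q j).
    apply: contra (stable (row_node q j |: S)) => f.
    by apply/color_stepP; exists (col_node s l), (row_node q j).
  rewrite /forces /edge_star edge_with_node Tj eqxx andbT eqEsubset andbC sub1set.
  rewrite inE edge_node Tj jS /= => /subsetPn[h]; rewrite !inE => /andP[].
  move=> /[dup] /edge_row_node[k ->]; rewrite edge_node => Tk kS nkj.
  by exists k; rewrite inE -(inj_eq (@row_node_inj s q)).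
have /fin_all_exists[a aP] l := @balanced_column R (T^~ l) W (second l).
exists (\matrix_(k, l) a l k) => [k l|].
  by rewrite mxE; exact: (aP l).1.
apply/rowP=> l; rewrite !mxE -[RHS](aP l).2 [RHS]big_mkcond /=.
by apply: eq_bigr => k _; rewrite !mxE inE; case: ifP; rewrite ?mul1r ?mul0r.
Qed.

Lemma derived_set_kernelP (R : realType) (k : 'I_s) :
  (forall (A : 'M[R]_(s, q)) (z : 'rV[R]_s),
     pattern_class T A -> z *m A = 0 -> z 0 k = 0)
  <-> row_node q k \in derived_set T.
Proof.
split=> [ker0|kS A z TA zA]; last exact: derived_set_kernel TA zA _ kS.
have [A TA zA] := white_indicator_kernel R.
by have /eqP := ker0 A _ TA zA; rewrite mxE pnatr_eq0 eqb0 negbK.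
Qed.

End Kernel.

Lemma pattern_class_col_mx (R : realType) (m n q : nat)
    (M : 'M[symbol]_(m, q)) (N : 'M[symbol]_(n, q))
    (A : 'M[R]_(m, q)) (B : 'M[R]_(n, q)) :
  pattern_class (col_mx M N) (col_mx A B) <->
  pattern_class M A /\ pattern_class N B.
Proof.
split=> [TAB|[MA NB] i j].
  split=> i j; first by move: (TAB (lshift n i) j); rewrite !col_mxEu.
  by move: (TAB (rshift m i) j); rewrite !col_mxEd.
by case: (split_ordP i) => k ->; rewrite ?col_mxEu ?col_mxEd.
Qed.

Lemma independent_kernel (R : realType) (r q : nat)
    (M : 'M[symbol]_(1, q)) (N : 'M[symbol]_(r, q)) :
  independent R M N <->
  forall (A : 'M[R]_(1 + r, q)) (z : 'rV[R]_(1 + r)),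
    pattern_class (col_mx M N) A -> z *m A = 0 -> z 0 (lshift r ord0) = 0.
Proof.
split=> [indep A z|ker0 A B z1 z2 MA NB zAB].
  rewrite -[A]vsubmxK -[z]hsubmxK => /pattern_class_col_mx[MA NB].
  rewrite mul_row_col row_mxEl [lsubmx z]mx11_scalar mul_scalar_mx => zA.
  by rewrite mxE eqxx; apply: (indep _ _ _ (rsubmx z)^T MA NB); rewrite trmxK.
have := ker0 (col_mx A B) (row_mx z1%:M z2^T).
rewrite mul_row_col mul_scalar_mx row_mxEl mxE eqxx; apply=> //.
exact/pattern_class_col_mx.
Qed.

Theorem lemma21 (R : realType) (r p : nat)
    (M : 'M[symbol]_(1, p)) (N : 'M[symbol]_(r, p)) :
  independent R M N <-> node1 r p \in derived_set (col_mx M N).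
Proof.
have -> : node1 r p = row_node p (lshift r ord0) by apply: val_inj.
exact: iff_trans (independent_kernel R M N) (derived_set_kernelP _ R _).
Qed.
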